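(* Given a Minsky machine program $P$ with $n$ registers, one can compute a program $Q$ with $1+n$ registers and no self loops such that for every $\vec v\in\mathbb N^n$, $$(1,P)\text{ terminates from }(1,\vec v)\iff(1,Q)\text{ terminates from }(1,0::\vec v).$$
   Context: An instruction over $n$ registers is $\mathrm{INC}\,\alpha$ or $\mathrm{DEC}\,\alpha\,p$ with $\alpha<n$ and $p\in\mathbb N$. A machine $(s,[\iota_0;\dots;\iota_k])$ has $\iota_j$ at label $s+j$. A state is $(i,\vec v)$ with $i\in\mathbb N$ and $\vec v\in\mathbb N^n$. If $i$ labels an instruction, one step is as follows. - $\mathrm{INC}\,\alpha$ goes to $(i+1,\vec v[\alpha\mapsto v_\alpha+1])$. - $\mathrm{DEC}\,\alpha\,p$ goes to $(i+1,\vec v[\alpha\mapsto v_\alpha-1])$ if $v_\alpha>0$, and to $(p,\vec v)$ if $v_\alpha=0$. No step is possible when the program counter is outside the code. A machine terminates from a state if, after finitely many steps, it reaches a state with program counter outside the code. A machine $(1,Q)$ has a self loop if some instruction at label $i$ is of the form $\mathrm{DEC}\,\alpha\,i$. *)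

(* Defs.v *)
From Stdlib Require Import Relation_Operators.
From mathcomp Require Import all_boot.

Set Implicit Arguments.
Unset Strict Implicit.
Unset Printing Implicit Defensive.

(** ** Minsky machines *)

Inductive instr (n : nat) : Type :=
| INC of 'I_n
| DEC of 'I_n & nat.

Definition program (n : nat) := seq (instr n).

(* [(s, Q)] carries the j-th instruction of [Q] (from 0) at label [s + j]. *)
Definition machine (n : nat) := (nat * program n)%type.

Definition state (n : nat) := (nat * n.-tuple nat)%type.

Definition upd n (v : n.-tuple nat) (a : 'I_n) (x : nat) : n.-tuple nat :=
  [tuple if b == a then x else tnth v b | b < n].

Definition instr_at n (M : machine n) (i : nat) : option (instr n) :=
  if M.1 <= i then onth M.2 (i - M.1) else None.

Inductive step n (M : machine n) : state n -> state n -> Prop :=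
| step_INC i v a :
    instr_at M i = Some (INC a) ->
    step M (i, v) (i.+1, upd v a (tnth v a).+1)
| step_DEC_pos i v a p :
    instr_at M i = Some (DEC a p) -> 0 < tnth v a ->
    step M (i, v) (i.+1, upd v a (tnth v a).-1)
| step_DEC_zero i v a p :
    instr_at M i = Some (DEC a p) -> tnth v a = 0 ->
    step M (i, v) (p, v).

Definition outside n (M : machine n) (i : nat) : bool :=
  ~~ (M.1 <= i < M.1 + size M.2).

Definition terminates n (M : machine n) (st : state n) : Prop :=
  exists st', clos_refl_trans _ (step M) st st' /\ outside M st'.1.

Definition has_self_loop n (M : machine n) : Prop :=
  exists (i : nat) (a : 'I_n), instr_at M i = Some (DEC a i).

(** ** Computability of program transformations *)

(* The total recursive functions on natural numbers: minimization is only
   allowed when it is everywhere defined. Every closure clause characterizes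
   its result pointwise, so the class is closed under extensional equality. *)
Inductive recursive : forall k : nat, (k.-tuple nat -> nat) -> Prop :=
| rec_zero : recursive (fun _ : 0.-tuple nat => 0)
| rec_succ : recursive (fun v : 1.-tuple nat => (thead v).+1)
| rec_proj k (i : 'I_k) : recursive (fun v : k.-tuple nat => tnth v i)
| rec_comp k m (f : m.-tuple nat -> nat) (g : 'I_m -> k.-tuple nat -> nat)
    (h : k.-tuple nat -> nat) :
    recursive f -> (forall i, recursive (g i)) ->
    (forall v, h v = f [tuple g i v | i < m]) ->
    recursive h
| rec_prim k (f : k.-tuple nat -> nat) (g : k.+2.-tuple nat -> nat)
    (h : k.+1.-tuple nat -> nat) :
    recursive f -> recursive g ->
    (forall v : k.-tuple nat, h [tuple of 0 :: v] = f v) ->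
    (forall (x : nat) (v : k.-tuple nat),
        h [tuple of x.+1 :: v] = g [tuple of x :: h [tuple of x :: v] :: v]) ->
    recursive h
| rec_min k (f : k.+1.-tuple nat -> nat) (h : k.-tuple nat -> nat) :
    recursive f ->
    (forall v : k.-tuple nat, f [tuple of h v :: v] = 0) ->
    (forall (v : k.-tuple nat) (x : nat),
        x < h v -> f [tuple of x :: v] <> 0) ->
    recursive h.

(* Goedel numbers, built on the bijection [CodeSeq.code : seq nat -> nat]. *)
Definition instr_code n (c : instr n) : nat :=
  match c with
  | INC a => CodeSeq.code [:: val a]
  | DEC a p => CodeSeq.code [:: val a; p]
  end.

Definition program_code n (P : program n) : nat :=
  CodeSeq.code [seq instr_code c | c <- P].

(* A program does not determine its number of registers, which is therefore
   part of the input. *)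
Definition computable_transformation (r : nat -> nat)
    (F : forall n, program n -> program (r n)) : Prop :=
  exists f : 2.-tuple nat -> nat, recursive f /\
    forall n (P : program n),
      f [tuple n; program_code P] = program_code (F n P).

(* Main.v *)
(** Put an [INC] of the new register in front of every instruction of [P].  The
instruction labelled [i] then lives at [2i], and a jump to [p] becomes a jump to
[2p - 1], the [INC] in front of instruction [p]: jump targets are odd (or [0])
while jumping instructions have even labels, so there is no self loop.  The new
register merely counts the simulated steps.  Each instruction is translated
independently of its position, so on codes the translation is a right fold over
a list, computed by primitive recursion. *)
Require Import Defs.
From mathcomp Require Import all_boot.
From Stdlib Require Import Relation_Operators Operators_Properties.

Set Implicit Arguments.
Unset Strict Implicit.
Unset Printing Implicit Defensive.

(** * Layout of the interleaved program *)

(* Since [0.*2.-1 = 0], a jump to label [0] still leaves the code. *)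
Definition interleave_instr n (c : instr n) : instr n.+1 :=
  match c with
  | INC a => INC (lift ord0 a)
  | DEC a p => DEC (lift ord0 a) p.*2.-1
  end.

Fixpoint interleave n (P : program n) : program n.+1 :=
  if P is c :: P' then [:: INC ord0, interleave_instr c & interleave P'] else [::].

Lemma size_interleave n (P : program n) : size (interleave P) = (size P).*2.
Proof. by elim: P => //= c P ->. Qed.

Lemma instr_at_interleave_odd n (P : program n) i :
  instr_at (1, interleave P) i.*2.-1 = omap (fun=> INC ord0) (instr_at (1, P) i).
Proof.
rewrite /instr_at /=; case: i => [|i] //=; rewrite !subn1 /=.
by elim: P i => [|c P IHP] [|i] //=.
Qed.

Lemma instr_at_interleave_even n (P : program n) i :
  instr_at (1, interleave P) i.*2 = omap (@interleave_instr n) (instr_at (1, P) i).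
Proof.
rewrite /instr_at /=; case: i => [|i] //=; rewrite !subn1 /=.
by elim: P i => [|c P IHP] [|i] //=.
Qed.

Lemma interleave_no_self_loop n (P : program n) : ~ has_self_loop (1, interleave P).
Proof.
case=> i [a]; rewrite -(odd_double_half i); case: (odd i) => /=.
  (* An odd label has the form [i.*2.-1], so it can only carry [INC ord0]. *)
  rewrite add1n -[X in instr_at _ X]/(i./2.+1).*2.-1 instr_at_interleave_odd.
  by case: (instr_at _ _).
rewrite add0n instr_at_interleave_even /instr_at /=.
(* The label is even and positive, whereas a target is odd or [0]. *)
case: (i./2) => //= j; case: (onth _ _) => [[b|b [|p]]|] //= [_ /(congr1 odd)].
by rewrite /= !odd_double.
Qed.

(** * Simulation of runs in both directions *)

Lemma upd_cons n (v : n.-tuple nat) (x : nat) (a : 'I_n) (y : nat) :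
  upd [tuple of x :: v] (lift ord0 a) y = [tuple of x :: upd v a y].
Proof.
apply: eq_from_tnth => b; rewrite tnth_mktuple.
case: (unliftP ord0 b) => [b'|] ->; rewrite ?tnth0 // !tnthS tnth_mktuple.
by rewrite (inj_eq (@lift_inj _ ord0)).
Qed.

Lemma upd_head n (v : n.-tuple nat) (x y : nat) :
  upd [tuple of x :: v] ord0 y = [tuple of y :: v].
Proof.
apply: eq_from_tnth => b; rewrite tnth_mktuple.
by case: (unliftP ord0 b) => [b'|] ->; rewrite ?tnth0 // !tnthS.
Qed.

Lemma outside_interleave n (P : program n) i :
  outside (1, interleave P) i.*2.-1 = outside (1, P) i.
Proof.
rewrite /outside /= size_interleave !add1n; case: i => //= i.
by rewrite !ltnS ltn_double.
Qed.

(** Falling through from [i.*2] gives [i.*2.+1], which computes to [i.+1.*2.-1]; hence fall-through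
    and jump end in the same form. *)
Lemma step_interleave n (P : program n) i v j w x :
  step (1, P) (i, v) (j, w) ->
  step (1, interleave P) (i.*2, [tuple of x :: v])
       (j.*2.-1, [tuple of x :: w]).
Proof.
move=> s; inversion s as [? ? a Pi|? ? a p Pi|? ? a p Pi]; subst; last first.
- apply: (@step_DEC_zero _ (1, interleave P) _ _ (lift ord0 a)).
    by rewrite instr_at_interleave_even Pi.
  by rewrite tnthS.
- rewrite -upd_cons -(tnthS x).
  apply: (@step_DEC_pos _ (1, interleave P) _ _ _ p.*2.-1); last by rewrite tnthS.
  by rewrite instr_at_interleave_even Pi.
rewrite -upd_cons -(tnthS x).
by apply: (@step_INC _ (1, interleave P)); rewrite instr_at_interleave_even Pi.
Qed.

Lemma step_interleave_count n (P : program n) i (v : n.-tuple nat) (x : nat) c :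
  instr_at (1, P) i = Some c ->
  step (1, interleave P) (i.*2.-1, [tuple of x :: v]) (i.*2, [tuple of x.+1 :: v]).
Proof.
(* Label [0] carries no instruction, so [i.*2] is the successor of [i.*2.-1]. *)
move=> Pi; have i_gt0: 0 < i.*2 by case: i Pi.
rewrite -(upd_head v x x.+1) -[in x.+1](tnth0 x v) -{2}(prednK i_gt0).
by apply: (@step_INC _ (1, interleave P)); rewrite instr_at_interleave_odd Pi.
Qed.

Lemma terminates_interleave n (P : program n) i v x :
  terminates (1, P) (i, v) ->
  terminates (1, interleave P) (i.*2.-1, [tuple of x :: v]).
Proof.
case=> st' [/clos_rt_rt1n_iff + out_st'].
move def_st: (i, v) => st run.
(* The counter [x] is generalized, since it grows with each simulated step. *)
elim: run x out_st' i v def_st => {st st'} [st|st [j w] st' s _ IH] x out i v def_st.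
  exists (i.*2.-1, [tuple of x :: v]); split; first exact: rt_refl.
  by rewrite outside_interleave; rewrite -def_st in out.
rewrite -{st}def_st in s; have [st2 [run2 out2]] := IH x.+1 out j w erefl.
exists st2; split=> //.
have [c Pi]: exists c, instr_at (1, P) i = Some c.
  by inversion s; eexists; eassumption.
apply: rt_trans (rt_step _ _ _ _ (step_interleave_count v x Pi)) _.
exact: rt_trans (rt_step _ _ _ _ (step_interleave _ s)) run2.
Qed.

Lemma step_inv_odd n (P : program n) i (v : n.-tuple nat) (x : nat) st :
  step (1, interleave P) (i.*2.-1, [tuple of x :: v]) st ->
  0 < i /\ st = (i.*2, [tuple of x.+1 :: v]).
Proof.
move=> s; inversion s as [? ? a Qi|? ? a p Qi|? ? a p Qi]; subst;
  rewrite instr_at_interleave_odd in Qi; case Pi: (instr_at (1, P) i) Qi => [c|] //= [<-].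
by case: i {s} Pi => //= i _; rewrite upd_head tnth0.
Qed.

Lemma step_inv_even n (P : program n) i (v : n.-tuple nat) (x : nat) st :
  step (1, interleave P) (i.*2, [tuple of x :: v]) st ->
  exists j w, step (1, P) (i, v) (j, w) /\ st = (j.*2.-1, [tuple of x :: w]).
Proof.
move=> s.
inversion s as [? ? a Qi|? ? a p Qi va|? ? a p Qi va]; subst;
  rewrite instr_at_interleave_even in Qi; case Pi: (instr_at (1, P) i) Qi => [[b|b q]|] //=.
- case=> <-; exists i.+1, (upd v b (tnth v b).+1); split.
    exact: (@step_INC _ (1, P)).
  by rewrite upd_cons tnthS.
- case=> eb _; rewrite -eb tnthS in va *.
  exists i.+1, (upd v b (tnth v b).-1); split.
    exact: (@step_DEC_pos _ (1, P) _ _ _ q).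
  by rewrite upd_cons.
case=> eb <-; rewrite -eb tnthS in va; exists q, v; split=> //.
exact: (@step_DEC_zero _ (1, P) _ _ b).
Qed.

Lemma terminates_of_interleave n (P : program n) i (v : n.-tuple nat) (x : nat) :
  terminates (1, interleave P) (i.*2.-1, [tuple of x :: v]) ->
  terminates (1, P) (i, v).
Proof.
case=> st' [/clos_rt_rt1n_iff + out_st'].
move def_st: (i.*2.-1, _) => st run.
(* Single steps of the interleaved program also visit the state between a counting [INC] and its
   instruction; the invariant lets both positions stand for [i]. *)
have {def_st}: st = (i.*2.-1, [tuple of x :: v]) \/
     (0 < i /\ st = (i.*2, [tuple of x :: v])) by left.
elim: run out_st' i v x => {st st'} [st|st st1 st' s _ IH] out i v x.
  move=> def_st; exists (i, v); split; first exact: rt_refl.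
  rewrite /= -outside_interleave; case: def_st out => [-> //|[i_gt0 ->]].
  (* For positive [i], the labels [i.*2.-1] and [i.*2] are both inside the code or both outside. *)
  rewrite /outside /= size_interleave; case: i i_gt0 => // i _.
  by rewrite !add1n !ltnS /= ltn_double ltn_Sdouble.
case=> [|[_]] def_st; rewrite {}def_st in s.
  have [i_gt0 def_st1] := step_inv_odd s.
  by apply: (IH out i v x.+1); right.
have [j [w [s1 def_st1]]] := step_inv_even s.
have [st2 [run2 out2]] := IH out j w x (or_introl def_st1).
by exists st2; split=> //; apply: rt_trans run2; apply: rt_step.
Qed.

(** * Recursive functions of arithmetic *)

(** The composition clause asks only for pointwise agreement, so composing [f] with all projections
    yields [h]. *)
Lemma recursive_ext k (f h : k.-tuple nat -> nat) :
  f =1 h -> recursive f -> recursive h.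
Proof.
move=> fh rec_f; apply: (rec_comp rec_f (fun i => rec_proj i)) => v.
by rewrite -fh; congr f; apply: eq_from_tnth => i; rewrite tnth_mktuple.
Qed.

Lemma recursive_nth k i : i < k -> recursive (fun v : k.-tuple nat => nth 0 v i).
Proof.
move=> ltik; apply: recursive_ext (rec_proj (Ordinal ltik)) => v.
exact: tnth_nth.
Qed.

(** Reading arguments with [nth] makes them compute on explicit tuples. *)
Definition recursive1 (f : nat -> nat) :=
  recursive (fun v : 1.-tuple nat => f (nth 0 v 0)).

Definition recursive2 (f : nat -> nat -> nat) :=
  recursive (fun v : 2.-tuple nat => f (nth 0 v 0) (nth 0 v 1)).

Lemma recursive_comp1 f k (g : k.-tuple nat -> nat) :
  recursive1 f -> recursive g -> recursive (fun v => f (g v)).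
Proof.
move=> rec_f rec_g; apply: (rec_comp rec_f (fun=> rec_g)) => v.
by rewrite -(tnth_nth 0 _ ord0) tnth_mktuple.
Qed.

Lemma recursive_comp2 f k (g h : k.-tuple nat -> nat) :
  recursive2 f -> recursive g -> recursive h -> recursive (fun v => f (g v) (h v)).
Proof.
move=> rec_f rec_g rec_h.
pose gh (i : 'I_2) := if val i == 0 then g else h.
apply: (rec_comp rec_f (g := gh)) => [[[|i] lti]|v] //.
by rewrite -(tnth_nth 0 _ ord0) -(tnth_nth 0 _ ord_max) !tnth_mktuple.
Qed.

Lemma recursive_succ : recursive1 S.
Proof. by apply: recursive_ext rec_succ => v; rewrite /thead (tnth_nth 0). Qed.

Lemma recursive_const k c : recursive (fun _ : k.-tuple nat => c).
Proof.
elim: c => [|c]; last exact: recursive_comp1 recursive_succ.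
(* The nullary zero is composed with an empty family to reach arity [k]. *)
have noI (i : 'I_0) : recursive (fun _ : k.-tuple nat => 0) by case: i.
exact: (rec_comp rec_zero noI).
Qed.

Lemma recursive1_prim g a h :
  recursive2 g -> h 0 = a -> (forall x, h x.+1 = g x (h x)) -> recursive1 h.
Proof.
move=> rec_g h0 hS; apply: (rec_prim (recursive_const 0 a) rec_g) => //.
by move=> x v /=.
Qed.

Lemma recursive2_prim f g h :
    recursive1 f ->
    recursive (fun v : 3.-tuple nat => g (nth 0 v 0) (nth 0 v 1) (nth 0 v 2)) ->
    (forall y, h 0 y = f y) -> (forall x y, h x.+1 y = g x (h x y) y) ->
  recursive2 h.
Proof.
by move=> rec_f rec_g h0 hS; apply: (rec_prim rec_f rec_g) => [v|x v] /=.
Qed.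

Lemma recursive1_min f h :
    recursive2 f -> (forall x, f (h x) x = 0) ->
    (forall x y, y < h x -> f y x <> 0) ->
  recursive1 h.
Proof.
by move=> rec_f fh0 fh; apply: (rec_min rec_f) => [v|v y] /=; auto.
Qed.

Lemma recursive_pred : recursive1 predn.
Proof. by apply: (@recursive1_prim (fun x _ => x) 0) => //; exact: recursive_nth. Qed.

Lemma recursive_add : recursive2 addn.
Proof.
apply: (@recursive2_prim id (fun _ z _ => z.+1)) => //; first exact: recursive_nth.
exact: recursive_comp1 recursive_succ (recursive_nth _).
Qed.

Lemma recursive_sub : recursive2 subn.
Proof.
(* Primitive recursion acts on the first argument, so the flipped subtraction comes first. *)
have rec_sub : recursive2 (fun x y => y - x).
  apply: (@recursive2_prim id (fun _ z _ => z.-1)).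
  - exact: recursive_nth.
  - exact: recursive_comp1 recursive_pred (recursive_nth _).
  - exact: subn0.
  exact: (fun x y => subnS y x).
exact: (recursive_comp2 rec_sub (@recursive_nth 2 1 _) (@recursive_nth 2 0 _)).
Qed.

Lemma recursive_mul : recursive2 muln.
Proof.
apply: (@recursive2_prim (fun=> 0) (fun _ z y => y + z)) => //.
  exact: recursive_const.
exact: recursive_comp2 recursive_add (recursive_nth _) (recursive_nth _).
Qed.

Lemma recursive_double : recursive1 double.
Proof.
apply: (@recursive_ext _ (fun v => nth 0 v 0 + nth 0 v 0)).
  by move=> v; rewrite addnn.
exact: recursive_comp2 recursive_add (recursive_nth _) (recursive_nth _).
Qed.

Lemma recursive_exp2 : recursive1 (expn 2).
Proof.
apply: (@recursive1_prim (fun _ z => z.*2) 1) => //.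
  exact: recursive_comp1 recursive_double (recursive_nth _).
by move=> x; rewrite expnS mul2n.
Qed.

Lemma recursive_odd : recursive1 odd.
Proof.
apply: (@recursive1_prim (fun _ z => 1 - z) 0) => //.
  exact: recursive_comp2 recursive_sub (recursive_const _ _) (recursive_nth _).
by move=> x /=; case: (odd x).
Qed.

Lemma recursive_half : recursive1 half.
Proof.
(* The rounded-down halves of [x] and [x.+1] add up to [x]. *)
apply: (@recursive1_prim (fun x z => x - z) 0) => //.
  exact: recursive_comp2 recursive_sub (recursive_nth _) (recursive_nth _).
by move=> x; rewrite /= uphalf_half -{3}(odd_double_half x) -addnn addnA addnK.
Qed.

Lemma recursive_div_exp2 : recursive2 (fun x y => y %/ 2 ^ x).
Proof.
apply: (@recursive2_prim id (fun _ z _ => z./2)).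
- exact: recursive_nth.
- exact: recursive_comp1 recursive_half (recursive_nth _).
- by move=> y; rewrite divn1.
by move=> x y; rewrite expnSr divnMA divn2.
Qed.

Lemma recursive_logn2 : recursive1 (logn 2).
Proof.
(* The valuation is the least [k] with an odd quotient; the factor [x] stops the search at once for
   [x = 0], where [logn] is [0]. *)
apply: (@recursive1_min (fun k x => x * (1 - odd (x %/ 2 ^ k)))).
- apply: (recursive_comp2 recursive_mul (@recursive_nth 2 1 _)) => //.
  apply: (recursive_comp2 recursive_sub (recursive_const _ _)).
  exact: recursive_comp1 recursive_odd recursive_div_exp2.
- move=> [|x] //; set y := x.+1.
  have [m] := @pfactor_coprime 2 y isT isT.
  by rewrite coprime2n => odd_m {1 2}->; rewrite mulnK ?expn_gt0 // odd_m muln0.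
move=> x k ltk; have x_gt0: 0 < x by case: x ltk; rewrite ?logn0.
have: 2 ^ k.+1 %| x by rewrite pfactor_dvdn.
case/dvdnP=> q def_x; apply/eqP; rewrite muln_eq0 negb_or -lt0n x_gt0 /=.
by rewrite {1}def_x expnS mulnA mulnK ?expn_gt0 // oddM andbF.
Qed.

(** * Lists and their codes *)

(** The code of [x :: s] is [2 ^ x] times an odd number whose half, rounded down, is the code of
    [s]. The code [0] of the empty list is fixed. *)
Definition tail_code x := x %/ 2 ^ (logn 2 x).+1.

Lemma logn2_code x s : logn 2 (CodeSeq.code (x :: s)) = x.
Proof.
rewrite /= lognM ?expn_gt0 // pfactorK // [logn 2 _.+1]logn_coprime ?addn0 //.
by rewrite coprime2n /= odd_double.
Qed.

Lemma tail_codeE s : tail_code (CodeSeq.code s) = CodeSeq.code (behead s).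
Proof.
case: s => [|x s] //; rewrite /tail_code logn2_code /=.
by rewrite expnSr divnMl ?expn_gt0 // divn2 /= uphalf_double.
Qed.

Lemma recursive_tail_code : recursive1 tail_code.
Proof.
apply: (recursive_comp2 recursive_div_exp2); last exact: recursive_nth.
apply: (recursive_comp1 recursive_succ).
exact: recursive_logn2.
Qed.

Lemma iter_tail_code m s :
  iter m tail_code (CodeSeq.code s) = CodeSeq.code (drop m s).
Proof.
by elim: m => [|m IHm]; rewrite ?drop0 //= IHm tail_codeE -drop1 drop_drop.
Qed.

Lemma recursive_iter_tail_code : recursive2 (fun m x => iter m tail_code x).
Proof.
apply: (@recursive2_prim id (fun _ z _ => tail_code z)) => //.
  exact: recursive_nth.
exact: recursive_comp1 recursive_tail_code (recursive_nth _).
Qed.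

(** The formula codes the list with head [x] and tail coded by [y]. *)
Lemma recursive_cons_code : recursive2 (fun x y => 2 ^ x * y.*2.+1).
Proof.
apply: (recursive_comp2 recursive_mul).
  exact: recursive_comp1 recursive_exp2 (recursive_nth _).
apply: (recursive_comp1 recursive_succ).
exact: recursive_comp1 recursive_double (recursive_nth _).
Qed.

Lemma recursive_pos : recursive1 (fun x => 0 < x).
Proof.
apply: (@recursive1_prim (fun _ _ => 1) 0) => //.
exact: recursive_const.
Qed.

(** * The translation on codes *)

(** The exponent grows by one because [lift ord0] shifts registers. The tail [y] is [0] for [INC]
    and [2 ^ p] for a jump to [p]; the factor [0 < y] separates these cases. *)
Definition interleave_instr_code x :=
  let y := tail_code x in
  2 ^ (logn 2 x).+1 * ((0 < y) * 2 ^ (logn 2 y).*2.-1).*2.+1.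

Lemma interleave_instr_codeE n (c : instr n) :
  interleave_instr_code (instr_code c) = instr_code (interleave_instr c).
Proof.
case: c => [a|a p]; rewrite /interleave_instr_code tail_codeE logn2_code //=.
by rewrite (logn2_code p [::]) muln1 expn_gt0 mul1n muln1.
Qed.

Lemma recursive_interleave_instr_code : recursive1 interleave_instr_code.
Proof.
apply: (recursive_comp2 recursive_cons_code).
  by apply: (recursive_comp1 recursive_succ); exact: recursive_logn2.
apply: (recursive_comp2 recursive_mul).
  exact: recursive_comp1 recursive_pos recursive_tail_code.
apply: (recursive_comp1 recursive_exp2).
apply: (recursive_comp1 recursive_pred).
apply: (recursive_comp1 recursive_double).
exact: recursive_comp1 recursive_logn2 recursive_tail_code.
Qed.

(* The exponent [1] is the code of [INC ord0]. *)
Definition interleave_cons_code x y :=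
  2 ^ 1 * (2 ^ interleave_instr_code (logn 2 x) * y.*2.+1).*2.+1.

Lemma recursive_interleave_cons_code : recursive2 interleave_cons_code.
Proof.
apply: (recursive_comp2 recursive_cons_code (recursive_const _ _)).
apply: (recursive_comp2 recursive_cons_code); last exact: recursive_nth.
apply: (recursive_comp1 recursive_interleave_instr_code).
exact: recursive_comp1 recursive_logn2 (recursive_nth _).
Qed.

(* [interleave_code j x] encodes the image of what remains of the program coded by
   [x] after its first [x - j] instructions. Since the length of a program is
   at most its code, starting from [j = 0] is starting from the empty suffix. *)
Fixpoint interleave_code j x :=
  if j is j'.+1 then
    let y := iter (x - j) tail_code x in
    (0 < y) * interleave_cons_code y (interleave_code j' x)
  else 0.

Lemma recursive_interleave_code : recursive2 interleave_code.
Proof.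
apply: (@recursive2_prim (fun=> 0) (fun j z x =>
  let y := iter (x - j.+1) tail_code x in (0 < y) * interleave_cons_code y z)) => //.
  exact: recursive_const.
have rec_y : recursive (fun v : 3.-tuple nat =>
    iter (nth 0 v 2 - (nth 0 v 0).+1) tail_code (nth 0 v 2)).
  apply: (recursive_comp2 recursive_iter_tail_code); last exact: recursive_nth.
  apply: (recursive_comp2 recursive_sub); first exact: recursive_nth.
  exact: recursive_comp1 recursive_succ (recursive_nth _).
apply: (recursive_comp2 recursive_mul).
  exact: recursive_comp1 recursive_pos rec_y.
exact: recursive_comp2 recursive_interleave_cons_code rec_y (recursive_nth _).
Qed.

Lemma size_le_code s : size s <= CodeSeq.code s.
Proof.
elim: s => //= x s IHs; apply: (@leq_trans (CodeSeq.code s).*2.+1).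
  by rewrite ltnS (leq_trans IHs) // -addnn leq_addr.
by rewrite leq_pmull ?expn_gt0.
Qed.

Lemma interleave_codeE n (P : program n) :
  interleave_code (program_code P) (program_code P) = program_code (interleave P).
Proof.
set x := program_code P.
suffices suffixE j : j <= x ->
    interleave_code j x = program_code (interleave (drop (x - j) P)).
  by rewrite suffixE // subnn drop0.
elim: j => [_|j IHj lt_jx]; cbn [interleave_code].
  by rewrite subn0 drop_oversize // -(size_map (@instr_code n)) size_le_code.
rewrite IHj ?(ltnW lt_jx) // iter_tail_code -map_drop subnS.
(* With [x - j = m.+1], this stage treats the suffix [drop m P], and the previous one has encoded
   the image of its [behead]. *)
have: 0 < x - j by rewrite subn_gt0.
case: (x - j) => //= m _.
have -> : drop m.+1 P = behead (drop m P) by rewrite -drop1 drop_drop.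
case: (drop m P) => [|c P'] //=.
rewrite muln_gt0 expn_gt0 mul1n /interleave_cons_code.
by rewrite (logn2_code (instr_code c) (map (@instr_code n) P')) interleave_instr_codeE.
Qed.

Theorem theorem6p1 :
  { F : forall n : nat, program n -> program (1 + n)
  | computable_transformation F /\
    forall (n : nat) (P : program n),
      ~ has_self_loop (1, F n P) /\
      forall v : n.-tuple nat,
        terminates (1, P) (1, v) <->
        terminates (1, F n P) (1, [tuple of 0 :: v]) }.
Proof.
exists interleave; split.
  (* The program code is both the recursion depth and the list to translate. *)
  exists (fun v => interleave_code (nth 0 v 1) (nth 0 v 1)); split.
    exact: recursive_comp2 recursive_interleave_code (recursive_nth _) (recursive_nth _).
  by move=> n P; apply: interleave_codeE.
move=> n P; split=> [|v]; first exact: interleave_no_self_loop.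
(* The start label agrees, since [1.*2.-1] computes to [1]. *)
split; first exact: (@terminates_interleave n P 1 v 0).
exact: (@terminates_of_interleave n P 1 v 0).
Qed.
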